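(* Let $G=(V,E)$ be a finite graph and let $A^c$ be its complemented adjacency matrix. For every $J\subseteq V$ the following conditions are equivalent: (i) the column vectors $A^c[V,j]$ $(j\in J)$ are independent; (ii) $J$ has a witness in $A^c$; (iii) $\mathrm{ht}\,\widehat{\mathcal S_J}=|J|$, where $\widehat{\mathcal S_J}=\{\mathrm{St}(J')\mid J'\subseteq J\}$ ordered by inclusion; (iv) $J$ is a transversal of the partition of successive differences for some chain of $\mathrm{Fl}\,G$; (v) $J$ is a partial transversal of the partition of successive differences for some maximal chain of $\mathrm{Fl}\,G$.
   Context: Graphs are finite, undirected, without loops or multiple edges. For $v\in V$, $\mathrm{St}(v)$ is the set of vertices adjacent to $v$; for $W\subseteq V$, $\mathrm{St}(W)=\bigcap_{w\in W}\mathrm{St}(w)$, with $\mathrm{St}(\emptyset)=V$. $\mathrm{Fl}\,G=\{\mathrm{St}(W)\mid W\subseteq V\}$, ordered by inclusion (the lattice of flats). The height $\mathrm{ht}\,P$ of a finite poset $P$ is the maximum $k$ such that there is a chain $p_0<p_1<\dots<p_k$ in $P$. $A^c$ is the $V\times V$ boolean matrix whose $(i,j)$ entry is $0$ if $\{i,j\}\in E$ and $1$ otherwise (so diagonal entries are $1$); $A^c[I,J]$ denotes the submatrix with rows in $I$ and columns in $J$. The superboolean semiring $\mathbb{SB}=\{0,1,1^\nu\}$ has addition $0+x=x$, $1+1=1^\nu$, $1^\nu+x=1^\nu$ for all $x$, and multiplication $0\cdot x=0$, $1\cdot1=1$, $1\cdot1^\nu=1^\nu\cdot1^\nu=1^\nu$.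 Vectors $C_1,\dots,C_m\in\mathbb{SB}^n$ are dependent if there are $\lambda_1,\dots,\lambda_m\in\{0,1\}$, not all zero, such that every coordinate of $\lambda_1C_1+\dots+\lambda_mC_m$ lies in $\{0,1^\nu\}$; otherwise they are independent (boolean matrices are viewed as matrices over $\mathbb{SB}$). A square boolean matrix is nonsingular if by permuting its rows and permuting its columns independently it can be brought to lower triangular form with all diagonal entries $1$ and all entries above the diagonal $0$. $J$ has a witness in $A^c$ if there is $I\subseteq V$ with $|I|=|J|$ and $A^c[I,J]$ nonsingular. For a chain $X_0\supset X_1\supset\dots\supset X_k$ of subsets, a set $\{y_1,\dots,y_k\}$ is a transversal of the partition of successive differences if $y_i\in X_{i-1}\setminus X_i$ for $i=1,\dots,k$; a partial transversal is a subset of a transversal. *)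

(* Defs.v *)
From HB Require Import structures.
From mathcomp Require Import all_boot all_algebra all_fingroup.

Set Implicit Arguments.
Unset Strict Implicit.
Unset Printing Implicit Defensive.

Import GRing.Theory.

(* The superboolean semiring {0, 1, 1^nu}. *)
Inductive SB : Type := SB0 | SB1 | SBnu.

Definition SB_code (x : SB) : 'I_3 :=
  match x with SB0 => inord 0 | SB1 => inord 1 | SBnu => inord 2 end.

Definition SB_decode (i : 'I_3) : SB :=
  match val i with 0 => SB0 | 1 => SB1 | _ => SBnu end.

Lemma SB_codeK : cancel SB_code SB_decode.
Proof. by case; rewrite /SB_decode /= inordK. Qed.

HB.instance Definition _ := Countable.copy SB (can_type SB_codeK).
HB.instance Definition _ : isFinite SB := CanIsFinite SB_codeK.

Definition SB_add (x y : SB) : SB :=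
  match x, y with
  | SB0, z | z, SB0 => z
  | _, _ => SBnu
  end.

Definition SB_mul (x y : SB) : SB :=
  match x, y with
  | SB0, _ | _, SB0 => SB0
  | SB1, SB1 => SB1
  | _, _ => SBnu
  end.

Fact SB_addA : associative SB_add. Proof. by do 3!case. Qed.
Fact SB_addC : commutative SB_add. Proof. by do 2!case. Qed.
Fact SB_add0 : left_id SB0 SB_add. Proof. by case. Qed.
Fact SB_mulA : associative SB_mul. Proof. by do 3!case. Qed.
Fact SB_mulC : commutative SB_mul. Proof. by do 2!case. Qed.
Fact SB_mul1 : left_id SB1 SB_mul. Proof. by case. Qed.
Fact SB_mulDl : left_distributive SB_mul SB_add. Proof. by do 3!case. Qed.
Fact SB_mul0 : left_zero SB0 SB_mul. Proof. by case. Qed.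
Fact SB_1_neq0 : SB1 != SB0. Proof. by apply/eqP. Qed.

HB.instance Definition _ := GRing.isNmodule.Build SB SB_addA SB_addC SB_add0.
HB.instance Definition _ := GRing.Nmodule_isComNzSemiRing.Build SB
  SB_mulA SB_mulC SB_mul1 SB_mulDl SB_mul0 SB_1_neq0.

Definition SB_of_bool (b : bool) : SB := if b then SB1 else SB0.

(* Dependence of the family (C j)_(j in J) of vectors of SB^V. *)
Definition dependent (V U : finType) (J : {set U}) (C : U -> V -> SB) : Prop :=
  exists lam : U -> SB,
    [/\ forall j, j \in J -> lam j \in [:: SB0; SB1],
        exists2 j, j \in J & lam j != SB0
      & forall i, (\sum_(j in J) lam j * C j i)%R \in [:: SB0; SBnu]].

Definition independent (V U : finType) (J : {set U}) (C : U -> V -> SB) : Prop :=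
  ~ dependent J C.

Definition lower_unitriangular n (B : 'M[bool]_n) : Prop :=
  (forall i, B i i = true) /\ (forall i j : 'I_n, i < j -> B i j = false).

Definition nonsingular n (B : 'M[bool]_n) : Prop :=
  exists s t : 'S_n, lower_unitriangular (row_perm s (col_perm t B)).

Definition submatrix (V : finType) (A : V -> V -> bool) (I J : {set V}) :
    'M[bool]_(#|I|, #|J|) :=
  \matrix_(i, j) A (enum_val i) (enum_val j).

Definition has_witness (V : finType) (A : V -> V -> bool) (J : {set V}) : Prop :=
  exists (I : {set V}) (eqIJ : #|I| = #|J|),
    nonsingular (castmx (eqIJ, erefl #|J|) (submatrix A I J)).

(* The bound #|P| is harmless: p_0 < ... < p_k are k.+1 distinct elements of
   P when lt is a strict order. *)
Definition height (T : finType) (lt : rel T) (P : {set T}) : nat :=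
  \max_(k < #|P| | [exists p : k.+1.-tuple T,
                      all (fun x => x \in P) p && sorted lt p]) k.

Section Chains.

Variable V : finType.
Implicit Types (F : {set {set V}}) (X : {set V}) (s : seq {set V}).

(* A chain X_0 > X_1 > ... > X_k is given by its largest element X_0 = X and
   the sequence s = X_1, ..., X_k. *)
Definition dchain F X s : bool :=
  all (fun Y => Y \in F) (X :: s) && path (fun Y Z : {set V} => Z \proper Y) X s.

Definition max_dchain F X s : Prop :=
  dchain F X s /\
  forall X' s', dchain F X' s' ->
    {subset X :: s <= X' :: s'} -> {subset X' :: s' <= X :: s}.

(* X_0 \ X_1, ..., X_(k-1) \ X_k *)
Definition differences X s : seq {set V} := pairmap (fun Y Z : {set V} => Y :\: Z) X s.

Definition is_transv (D : seq {set V}) (J : {set V}) : Prop :=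
  exists2 y : seq V, all2 (fun v (B : {set V}) => v \in B) y D & J = [set v in y].

Definition is_partial_transv (D : seq {set V}) (J : {set V}) : Prop :=
  exists2 J', is_transv D J' & J \subset J'.

End Chains.

(* A graph on V is given by its symmetric irreflexive adjacency relation e. *)
Section Graphs.

Variables (V : finType) (e : rel V).

Definition star (v : V) : {set V} := [set u | e v u].

Definition St (W : {set V}) : {set V} := \bigcap_(w in W) star w.

Definition Fl : {set {set V}} := [set St W | W : {set V}].

Definition S_hat (J : {set V}) : {set {set V}} :=
  [set St J' | J' : {set V} in powerset J].

Definition compl_adj : V -> V -> bool := fun i j => ~~ e i j.

End Graphs.

(* Main.v *)
Require Import Defs.
From HB Require Import structures.
From mathcomp Require Import all_boot all_algebra all_fingroup.

(** Peeling columns off an independent family one at a time, each time with a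
    row meeting what is left in a single [1], gives a triangular witness; the
    rows of a witness show that the sets [St {y_i, ..., y_k}] form a strict
    chain in [S_hat J], and [X |-> J :&: St X] is strictly antitone on [S_hat J],
    so no chain there is longer and [St] maps a chain of length [#|J|] to a chain
    of flats with transversal [J].  Partial transversals of a chain are the sets
    whose elements are separated by its members, a condition that survives
    refinement.  Finally, for a nonempty set [K] separated by a chain of flats,
    the largest flat [St W] of the chain not containing [K] misses exactly one
    element of [K], and some [w] in [W] is a row with a single [1] in [K]. *)

Set Implicit Arguments.
Unset Strict Implicit.
Unset Printing Implicit Defensive.

Import GRing.Theory.

(** * Superboolean independence and triangular witnesses *)

Section Independence.

Variables (V : finType) (A : V -> V -> bool).
Implicit Types J K : {set V}.

Lemma SB_natr n : ((1 *+ n)%R : SB) \in [:: SB0; SBnu] = (n != 1).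
Proof. have [eq10 eq1n] : (SB1 == SB0) = false /\ (SB1 == SBnu) = false.
  by split; apply/eqP.
case: n => [|[|n]]; rewrite !inE ?eqxx ?mulr1n ?eq10 ?eq1n //.
by rewrite mulrS (mulrS _ n); case: (1 *+ n)%R; rewrite /= eqxx orbT. Qed.

(** Coefficients in [{0, 1}] amount to the choice of a set [K] of columns, and row [i] of their sum
    is [1] added to itself as often as row [i] meets [K]. By [SB_natr] this avoids [{0, 1^nu}] only
    when the count is exactly one. *)
Lemma independentP J :
  independent J (fun j i => SB_of_bool (A i j)) <->
  (forall K, K \subset J -> K != set0 -> exists i, #|[set k in K | A i k]| = 1).
Proof.
split=> [indJ K sKJ K_neq0 | single [lam [lam01 [j0 j0J lam_j0] sum_lam]]].
  case: (pickP (fun i => #|[set k in K | A i k]| == 1)) => [i /eqP|no_row].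
    by exists i.
  case: indJ; exists (fun j => SB_of_bool (j \in K)); split.
  - by move=> j _; rewrite !inE; case: (j \in K); rewrite /= eqxx ?orbT.
  - by case/set0Pn: K_neq0 => k kK; exists k; rewrite ?(subsetP sKJ) // kK SB_1_neq0.
  move=> i; rewrite (bigID [in K]) /= [X in (_ + X)%R]big1 => [|j /andP[_]];
    last by move/negbTE->.
  rewrite addr0 (eq_bigl [in K]) => [|j]; last first.
    by rewrite /= andb_idl //; apply: (subsetP sKJ).
  rewrite (eq_bigr (fun j => if A i j then 1 else 0)%R) => [|j -> /=]; last first.
    by case: (A i j).
  rewrite -big_mkcondr /= -big_set sumr_const SB_natr.
  by rewrite no_row.
pose K := [set j in J | lam j != SB0].
have sKJ : K \subset J by apply/subsetP=> j; rewrite inE => /andP[].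
have [|i /eqP/cards1P[k defk]] := single K sKJ.
  by apply/set0Pn; exists j0; rewrite inE j0J.
have : k \in [set k] by rewrite inE.
rewrite -defk !inE -andbA => /and3P[kJ lam_k Aik].
(* Column [k] alone contributes to row [i], so the coordinate there is [SB1], against dependence. *)
have := sum_lam i; rewrite (bigD1 k) //= big1 => [|j /andP[jJ j_neq_k]].
  have := lam01 k kJ; rewrite !inE (negbTE lam_k) addr0 Aik /= => /eqP->.
  by have := SB_natr 1; rewrite !inE => ->.
have [->|lam_j] := eqVneq (lam j) SB0; first by case: SB_of_bool.
have : j \notin [set k] by rewrite inE.
by rewrite -defk !inE jJ lam_j /= => /negbTE->; case: (lam j).
Qed.

(** A witness with its two permutations absorbed into the listings [x] of rows and [y] of columns.
    Injectivity is not demanded: the triangular shape forces it. *)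
Definition triangular J n (x y : 'I_n -> V) : Prop :=
  [/\ forall i, y i \in J, forall i, A (x i) (y i)
    & forall i j : 'I_n, i < j -> ~~ A (x i) (y j)].

Lemma triangular_injr J n (x y : 'I_n -> V) : triangular J x y -> injective y.
Proof.
move=> [_ diag upper] i j eq_y; apply: val_inj.
case: (ltngtP i j) => // /upper; first by rewrite -eq_y diag.
by rewrite eq_y diag.
Qed.

Lemma triangular_injl J n (x y : 'I_n -> V) : triangular J x y -> injective x.
Proof.
move=> [_ diag upper] i j eq_x; apply: val_inj.
case: (ltngtP i j) => // /upper; first by rewrite eq_x diag.
by rewrite -eq_x diag.
Qed.

Lemma triangular_exists J :
    (forall K, K \subset J -> K != set0 -> exists i, #|[set k in K | A i k]| = 1) ->
  exists x y : 'I_#|J| -> V, triangular J x y.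
Proof.
move: {-1}#|J| (erefl #|J|) => n; elim: n J => [|n IHn] J cardJ single.
  have no_ord (i : 'I_0) : V by case: i.
  by exists no_ord, no_ord; split=> -[].
have [||r /eqP/cards1P[c defc]] := single J; rewrite -?card_gt0 ?cardJ //.
have : c \in [set c] by rewrite inE.
rewrite -defc !inE => /andP[cJ Arc].
have [||x [y [yJ diag upper]]] := IHn (J :\ c).
- by move: cardJ; rewrite (cardsD1 c) cJ => -[].
- by move=> K sKJ; apply: single; apply: subset_trans sKJ (subsetDl _ _).
(* Row [r] and column [c] go first: [r] meets [J] only in [c], so the rest of the first row
   vanishes. *)
exists (fun i => oapp x r (unlift ord0 i)), (fun i => oapp y c (unlift ord0 i)).
split=> [i|i|i j].
- by case: (unliftP ord0 i) => //= k _; have /setD1P[] := yJ k.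
- by case: (unliftP ord0 i) => /=.
case: (unliftP ord0 j) => [j'|] -> //=; case: (unliftP ord0 i) => [i'|] -> //=.
  exact: upper.
move=> _; have /setD1P[y_neq_c y_in] := yJ j'.
have : y j' \notin [set c] by rewrite inE.
by rewrite -defc inE y_in.
Qed.

Lemma has_witnessP J :
  has_witness A J <-> exists x y : 'I_#|J| -> V, triangular J x y.
Proof.
split=> [[I [eqIJ [s [t [diag upper]]]]] | [x [y tri]]].
  exists (fun i => enum_val (cast_ord (esym eqIJ) (s i))), (fun i => enum_val (t i)).
  split=> [i|i|i j lt_ij]; first exact: enum_valP.
    by have := diag i; rewrite !mxE castmxE !mxE cast_ord_id.
  by have := upper i j lt_ij; rewrite !mxE castmxE !mxE cast_ord_id => ->.
have [yJ diag upper] := tri.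
have injx := triangular_injl tri; have injy := triangular_injr tri.
pose I := [set x i | i : 'I_#|J|]; have xI i : x i \in I by apply: imset_f.
have eqIJ : #|I| = #|J| by rewrite card_imset // card_ord.
(* The permutations send [i] to the positions of [x i] and [y i] in the enumerations of [I] and
   [J]. *)
pose s i := cast_ord eqIJ (enum_rank_in (xI i) (x i)).
pose t i := enum_rank_in (yJ i) (y i).
have sK i : enum_val (cast_ord (esym eqIJ) (s i)) = x i.
  by rewrite cast_ordK enum_rankK_in.
have tK i : enum_val (t i) = y i by rewrite enum_rankK_in.
have injs : injective s by move=> i j eq_s; apply: injx; rewrite -!sK eq_s.
have injt : injective t by move=> i j eq_t; apply: injy; rewrite -!tK eq_t.
exists I, eqIJ, (perm injs), (perm injt); split=> [i|i j lt_ij].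
  by rewrite !mxE castmxE !mxE cast_ord_id !permE sK tK diag.
by rewrite !mxE castmxE !mxE cast_ord_id !permE sK tK; apply/negbTE/upper.
Qed.

End Independence.

(** * Chains realizing the height of a finite strict order *)

Section Height.

Variables (T : finType) (lt : rel T).
Hypotheses (lt_irr : irreflexive lt) (lt_trans : transitive lt).
Implicit Type P : {set T}.

Lemma leq_height P k (p : k.+1.-tuple T) :
  {subset p <= P} -> sorted lt p -> k <= height lt P.
Proof.
move=> sub_p sorted_p.
have lt_kP : k < #|P|.
  rewrite -(size_tuple p) -(card_uniqP (sorted_uniq lt_trans lt_irr sorted_p)).
  by apply/subset_leq_card/subsetP.
rewrite /height -[k]/(val (Ordinal lt_kP)); apply: leq_bigmax_cond.
by apply/existsP; exists p; rewrite sorted_p andbT; apply/allP.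
Qed.

Lemma height_attained P : P != set0 ->
  exists X s, [/\ {subset X :: s <= P}, path lt X s & size s = height lt P].
Proof.
case/set0Pn=> X0 X0P; have P_gt0 : 0 < #|P| by apply/card_gt0P; exists X0.
pose C := [pred k : 'I_#|P| | [exists p : k.+1.-tuple T,
                                 all (fun x => x \in P) p && sorted lt p]].
have C_gt0 : 0 < #|C|.
  apply/card_gt0P; exists (Ordinal P_gt0); apply/existsP.
  by exists [tuple X0]; rewrite /= X0P.
have [k /existsP[p /andP[/allP sub_p sorted_p]]] := eq_bigmax_cond val C_gt0.
rewrite -[bigop _ _ _]/(height lt P) => ->.
case: p sub_p sorted_p => -[|X s] //= size_s sub_s path_s; exists X, s; split=> //.
by apply/eqP; rewrite -eqSS.
Qed.

End Height.

(** * Descending chains of sets and their partial transversals *)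

Section Transversals.

Variable V : finType.
Implicit Types (X Y Z J : {set V}) (s : seq {set V}) (c F : {set {set V}}).

Local Notation gtset := (fun Y Z : {set V} => Z \proper Y).
Local Notation picks := (all2 (fun v (B : {set V}) => v \in B)).

Lemma gtset_trans : transitive gtset.
Proof. by move=> Y X Z /[swap]; apply: proper_trans. Qed.

Lemma gtset_path_sub X s Y : path gtset X s -> Y \in X :: s -> Y \subset X.
Proof.
move=> /(order_path_min gtset_trans)/allP lt_X /predU1P[->//|/lt_X].
exact: proper_sub.
Qed.

Lemma gtset_path_size X s : path gtset X s -> size s + #|last X s| <= #|X|.
Proof.
elim: s X => //= Y s IHs X /andP[/proper_card ltYX /IHs].
by rewrite addSn => /leq_ltn_trans; apply.
Qed.

Lemma transv_sub X s y : path gtset X s ->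
  picks y (differences X s) -> {subset y <= X}.
Proof.
elim: s X y => [|Y s IHs] X [|v y] //= /andP[ltYX path_s].
case/andP=> /setDP[vX _] /(IHs _ _ path_s) sub_y u /predU1P[->//|/sub_y].
exact/subsetP/proper_sub.
Qed.

Lemma transv_uniq X s y : path gtset X s ->
  picks y (differences X s) -> uniq y.
Proof.
elim: s X y => [|Y s IHs] X [|v y] //= /andP[_ path_s].
case/andP=> /setDP[_ vY] tr; rewrite (IHs _ _ path_s tr) andbT.
by apply: contra vY; exact: (transv_sub path_s tr).
Qed.

(** For a descending chain [s], this says that [J] lies in the largest member, misses the smallest,
    and has at most one element in each difference. Only membership in [s] is used, so the condition
    survives refinement. *)
Definition separated s J : Prop :=
  [/\ forall u, u \in J -> exists2 Y, Y \in s & u \in Y,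
      forall u, u \in J -> exists2 Y, Y \in s & u \notin Y
    & forall u v, u \in J -> v \in J -> u != v ->
        exists2 Y, Y \in s & (u \in Y) != (v \in Y)].

Lemma separated_sub (s1 s2 : seq {set V}) (J1 J2 : {set V}) :
    {subset s1 <= s2} -> J2 \subset J1 -> separated s1 J1 -> separated s2 J2.
Proof.
move=> sS /subsetP sJ [above below sep]; split.
- by move=> u /sJ/above[Y /sS]; exists Y.
- by move=> u /sJ/below[Y /sS]; exists Y.
- by move=> u v /sJ uJ /sJ vJ /(sep u v uJ vJ)[Y /sS]; exists Y.
Qed.

(** The second set [Y] omits the first pick [v] but contains all later ones, so it splits [v] from
    them; induction treats the later picks. *)
Lemma transv_separated X s J : path gtset X s ->
  is_transv (differences X s) J -> separated (X :: s) J.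
Proof.
move=> path_s [y tr ->]; elim: s X y path_s tr => [|Y s IHs] X [|v y] //=.
  by move=> _ _; split=> u; rewrite !inE.
case/andP=> ltYX path_s /andP[/setDP[vX vY] tr].
have sub_y := transv_sub path_s tr.
have [above below sep] := IHs _ _ path_s tr.
have weaken Z : Z \in Y :: s -> Z \in X :: Y :: s by rewrite (in_cons X) => ->; rewrite orbT.
split=> [u|u|u w]; rewrite !inE.
- case/predU1P=> [->|uy]; first by exists X; rewrite ?inE ?eqxx.
  by have [|Z /weaken] := above u; rewrite ?inE //; exists Z.
- case/predU1P=> [->|uy]; first by exists Y; rewrite ?inE ?eqxx ?orbT.
  by have [|Z /weaken] := below u; rewrite ?inE //; exists Z.
have YXs : Y \in X :: Y :: s by rewrite !inE eqxx orbT.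
case/predU1P=> [->|uy] /predU1P[->|wy] neq_uw.
- by rewrite eqxx in neq_uw.
- by exists Y; rewrite // (negbTE vY) sub_y.
- by exists Y; rewrite // (negbTE vY) sub_y.
by have [|||Z /weaken] := sep u w; rewrite ?inE //; exists Z.
Qed.

Lemma separated_partial_transv X s J : path gtset X s ->
  separated (X :: s) J -> is_partial_transv (differences X s) J.
Proof.
elim: s X J => [|Y s IHs] X J /=.
  move=> _ [above below _]; exists set0; first by exists [::] => //; apply/setP.
  apply/subsetP=> u uJ; have [_ /predU1P[->|//] uX] := above u uJ.
  by have [_ /predU1P[->|//]] := below u uJ; rewrite uX.
case/andP=> ltYX path_s [above below sep]; have sYX := subsetP (proper_sub ltYX).
have sub_Y Z u : Z \in Y :: s -> u \in Z -> u \in Y.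
  by move=> /(gtset_path_sub path_s)/subsetP; apply.
have [|_ [y tr ->] sJy] := IHs Y (J :&: Y) path_s.
  split=> [u|u|u v]; rewrite !inE.
  - by case/andP=> _ uY; exists Y; rewrite ?inE ?eqxx.
  - case/andP=> uJ uY; have [Z /predU1P[->|Zs] uZ] := below u uJ; last by exists Z.
    by rewrite sYX in uZ.
  - case/andP=> uJ uY /andP[vJ vY] neq_uv.
    have [Z /predU1P[->|Zs] uZ] := sep u v uJ vJ neq_uv; last by exists Z.
    by rewrite !sYX in uZ.
have uX u : u \in J -> u \in X.
  by case/above=> Z /predU1P[->//|Zs /(sub_Y _ _ Zs)/sYX].
(* No member of the chain splits two elements of [X :\: Y], so [J] has at most one there; if it has
   none, any element of the difference fills the slot. *)
have [v vXY Jv] : exists2 v, v \in X :\: Y & J :\: Y \subset [set v].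
  have [JY0|[v /setDP[vJ vY]]] := set_0Vmem (J :\: Y).
    by have /properP[_ [v vX vY]] := ltYX; exists v; rewrite ?JY0 ?sub0set ?inE ?vX ?vY.
  exists v; first by rewrite inE vY uX.
  apply/subsetP=> u /setDP[uJ uY]; rewrite inE; apply: contraT => neq_uv.
  have [Z /predU1P[->|Zs]] := sep u v uJ vJ neq_uv; first by rewrite !uX.
  by rewrite (contraNF (sub_Y _ _ Zs) uY) (contraNF (sub_Y _ _ Zs) vY).
exists [set w in v :: y]; first by exists (v :: y); rewrite //= vXY.
apply/subsetP=> u uJ; rewrite !inE; have [uY|uY] := boolP (u \in Y).
  by have := subsetP sJy u; rewrite !inE uJ uY => ->; rewrite ?orbT.
by have := subsetP Jv u; rewrite !inE uJ uY => ->.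
Qed.

(** Chains as sets of sets rather than sequences, so that [maxset_exists] can produce maximal
    ones. *)
Definition comparable_family c :=
  [forall X in c, forall Y in c, (X \subset Y) || (Y \subset X)].

Lemma dchain_comparable F X s : dchain F X s ->
  ([set Y in X :: s] \subset F) && comparable_family [set Y in X :: s].
Proof.
case/andP=> /allP sub_s path_s; apply/andP; split.
  by apply/subsetP=> Y; rewrite inE; apply: sub_s.
apply/forall_inP=> Y; rewrite inE => Ys; apply/forall_inP=> Z; rewrite inE.
elim: s X path_s Ys {sub_s} => [|X' s IHs] X path_s.
  by rewrite !inE => /eqP-> /eqP->; rewrite subxx.
have sub_X := gtset_path_sub path_s.
move=> Ys Zs; move: (Ys) (Zs); rewrite in_cons => /predU1P[->|Ys'].
  by rewrite sub_X ?orbT.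
rewrite in_cons => /predU1P[->|Zs']; first by rewrite sub_X.
by case/andP: path_s => _ /IHs; apply.
Qed.

Lemma comparable_dchain F c : c != set0 -> c \subset F -> comparable_family c ->
  exists X s, dchain F X s /\ X :: s =i c.
Proof.
move=> c_neq0 /subsetP sub_c /forall_inP comp_c.
pose geset := fun Y Z : {set V} => Z \subset Y.
have geset_trans : transitive geset by move=> Y X Z /[swap]; apply: subset_trans.
have mem_sc : sort geset (enum c) =i c by move=> Y; rewrite mem_sort mem_enum.
have uniq_sc : uniq (sort geset (enum c)) by rewrite sort_uniq enum_uniq.
have sorted_sc : sorted geset (sort geset (enum c)).
  apply: (@sort_sorted_in _ [in c]); last by apply/allP=> Y; rewrite mem_enum.
  by move=> Y Z Yc Zc; rewrite /geset orbC; have /forall_inP := comp_c Y Yc; apply.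
(* Absence of repetitions upgrades the weak order of the sorted list to strict inclusion. *)
have {uniq_sc sorted_sc} : sorted gtset (sort geset (enum c)).
  apply: pairwise_sorted; move: sorted_sc uniq_sc.
  rewrite sorted_pairwise // uniq_pairwise => sorted_sc uniq_sc.
  have : pairwise geset (sort geset (enum c)) &&
      pairwise (fun Y Z => Y != Z) (sort geset (enum c)) by rewrite sorted_sc.
  rewrite -pairwise_relI; apply: sub_pairwise => Y Z /= /andP[sZY neqYZ].
  by rewrite properEneq eq_sym neqYZ.
case: (sort _ _) mem_sc => [|X s] mem_sc sorted_sc.
  by case/set0Pn: c_neq0 => X; rewrite -mem_sc.
exists X, s; split=> //; rewrite /dchain; apply/andP; split=> //.
by apply/allP=> Y; rewrite mem_sc; apply: sub_c.
Qed.

Lemma max_dchain_extends F X s : dchain F X s ->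
  exists X' s', max_dchain F X' s' /\ {subset X :: s <= X' :: s'}.
Proof.
move=> chain_s; have Xs : X \in X :: s by rewrite inE eqxx.
have [c /maxsetP[/andP[sub_c comp_c] max_c] /subsetP sub_sc] :=
  maxset_exists (P := fun c => (c \subset F) && comparable_family c)
    (dchain_comparable chain_s).
have c_neq0 : c != set0 by apply/set0Pn; exists X; apply: sub_sc; rewrite inE.
have [X' [s' [chain_s' mem_s']]] := comparable_dchain c_neq0 sub_c comp_c.
exists X', s'; split; last by move=> Y Ys; rewrite mem_s' sub_sc // inE.
split=> // X2 s2 /dchain_comparable chain_s2 sub_s2 Y Ys2; rewrite mem_s'.
rewrite -(max_c _ chain_s2) ?inE //.
by apply/subsetP=> Z; rewrite -mem_s' => /sub_s2 Zs2; rewrite in_set.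
Qed.

(** Strict descent of the traces on [J] leaves an element of [J] in every difference. *)
Lemma transv_choice J X s :
    path (fun Y Z => J :&: Z \proper J :&: Y) X s ->
  exists2 y : seq V, picks y (differences X s)
    & {subset y <= J}.
Proof.
elim: s X => [|Y s IHs] X /=; first by exists [::].
case/andP=> /properP[_ [v /setIP[vJ vX] vY]] /IHs[y tr sub_y].
move: vY; rewrite inE vJ /= => vY.
exists (v :: y); first by rewrite /= tr inE vX vY.
by move=> u /predU1P[->//|/sub_y].
Qed.

End Transversals.

(** * The Galois connection [St] and the chains of flats *)

Section Flats.

Variables (V : finType) (e : rel V).
Hypothesis e_sym : symmetric e.
Implicit Types (W X Y J K : {set V}) (s : seq {set V}).

Lemma StP W u : reflect (forall w, w \in W -> e w u) (u \in St e W).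
Proof.
by apply: (iffP bigcapP) => stW w /stW; rewrite inE.
Qed.

Lemma St_anti W X : W \subset X -> St e X \subset St e W.
Proof. by move=> /subsetP sWX; apply/subsetP=> u /StP stX; apply/StP=> w /sWX/stX. Qed.

Lemma sub_St_St W : W \subset St e (St e W).
Proof. by apply/subsetP=> w wW; apply/StP=> u /StP; rewrite e_sym; apply. Qed.

(** Writing [X] as [St e J'], the set [J :&: St e X] is the largest subset of [J] with the same star
    set, so [X] is recovered from its trace. *)
Lemma S_hat_closure J X : X \in S_hat e J -> St e (J :&: St e X) = X.
Proof.
case/imsetP=> J'; rewrite inE => sJ'J ->; apply/eqP; rewrite eqEsubset.
rewrite St_anti ?subsetI ?sJ'J ?sub_St_St //=.
exact: subset_trans (sub_St_St _) (St_anti (subsetIr _ _)).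
Qed.

Lemma S_hat_anti J X Y : X \in S_hat e J -> Y \in S_hat e J ->
  X \proper Y -> J :&: St e Y \proper J :&: St e X.
Proof.
move=> XJ YJ ltXY; rewrite properEneq setIS ?St_anti ?proper_sub // andbT.
apply: contraTneq ltXY => eqJ.
by rewrite -(S_hat_closure XJ) -eqJ S_hat_closure // properxx.
Qed.

Lemma S_hat_neq0 J : S_hat e J != set0.
Proof. by apply/set0Pn; exists (St e J); apply: imset_f; rewrite inE. Qed.

Local Notation ltset := (fun X Y : {set V} => X \proper Y).

Lemma height_S_hat_leq J : height ltset (S_hat e J) <= #|J|.
Proof.
have [X [s [sub_s path_s <-]]] := height_attained ltset (S_hat_neq0 J).
have path_J : path (fun Y Z => Z \proper Y) (J :&: St e X) [seq J :&: St e Y | Y <- s].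
  apply: (homo_path_in (f := fun Y => J :&: St e Y) _ _ path_s).
    exact: S_hat_anti.
  exact/allP.
have := gtset_path_size path_J; rewrite size_map => /(leq_trans (leq_addr _ _)).
by move=> size_s; apply: leq_trans size_s (subset_leq_card (subsetIl _ _)).
Qed.

Lemma height_S_hat_witness J : has_witness (compl_adj e) J ->
  height ltset (S_hat e J) = #|J|.
Proof.
case/has_witnessP=> x [y [yJ diag upper]]; apply/eqP; rewrite eqn_leq height_S_hat_leq.
(* Columns are dropped one by one from the front; at [i = #|J|] none is left and [p i] is all of
   [V], which gives [#|J|.+1] terms. *)
pose p i := St e [set y m | m : 'I_#|J| & i <= m].
have size_p : size (mkseq p #|J|.+1) == #|J|.+1 by rewrite size_mkseq.
apply: (leq_height _ _ (p := Tuple size_p)).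
- by move=> X; apply: properxx.
- by move=> X Y Z; apply: proper_trans.
- move=> X /mapP[i _ ->]; apply: imset_f; rewrite inE.
  by apply/subsetP=> u /imsetP[m _ ->].
apply/(sortedP set0) => i; rewrite size_mkseq => lt_iJ.
rewrite !nth_mkseq //; last exact: ltnW.
apply/properP; split.
  apply/St_anti/subsetP=> u /imsetP[m]; rewrite inE => lt_im ->.
  by apply: imset_f; rewrite inE ltnW.
(* A zero of [compl_adj] is an edge, so [x i'] is adjacent to every later [y m], but not to
   [y i']. *)
pose i' := Ordinal (lt_iJ : i < #|J|); exists (x i').
  apply/StP=> u /imsetP[m]; rewrite inE => lt_im ->.
  by have := upper i' m lt_im; rewrite negbK e_sym.
apply/negP=> /StP/(_ (y i')); rewrite e_sym (negbTE (diag i')).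
by move/(_ _)/notF; apply; apply: imset_f; rewrite inE.
Qed.

Lemma transv_of_height J : height ltset (S_hat e J) = #|J| ->
  exists X s, dchain (Fl e) X s /\ is_transv (differences X s) J.
Proof.
have [X [s [sub_s path_s <-]]] := height_attained ltset (S_hat_neq0 J) => size_s.
have path_J : path (fun Y Z => J :&: Z \proper J :&: Y) (St e X) [seq St e Y | Y <- s].
  apply: (homo_path_in (P := [in S_hat e J]) (f := St e) _ _ path_s); last exact/allP.
  by move=> Y Z YJ ZJ; apply: S_hat_anti.
have path_St : path (fun Y Z : {set V} => Z \proper Y) (St e X) [seq St e Y | Y <- s].
  apply: (homo_path_in (P := [in S_hat e J]) (f := St e) _ _ path_s); last exact/allP.
  move=> Y Z YJ ZJ ltYZ; have /proper_subn nsub := S_hat_anti YJ ZJ ltYZ.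
  rewrite properE (St_anti (proper_sub ltYZ)).
  by apply: contra nsub; apply: setIS.
have [y tr sub_y] := transv_choice path_J.
exists (St e X), [seq St e Y | Y <- s]; split.
  rewrite /dchain path_St andbT; apply/allP=> Y.
  rewrite -[_ :: _]/(map (St e) (X :: s)) => /mapP[Z _ ->].
  exact: imset_f.
exists y => //; apply/esym/eqP; rewrite eqEcard; apply/andP; split.
  by apply/subsetP=> u; rewrite inE; apply: sub_y.
(* The picks are distinct and as many as the steps of the chain, namely [#|J|], so they exhaust
   [J]. *)
rewrite cardsE (card_uniqP (transv_uniq path_St tr)) -size_s.
by move: tr; rewrite all2E size_pairmap size_map => /andP[/eqP->].
Qed.

Lemma single_row_of_separated X s J K : dchain (Fl e) X s ->
    separated (X :: s) J -> K \subset J -> K != set0 ->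
  exists i, #|[set k in K | compl_adj e i k]| = 1.
Proof.
move=> chain_s [_ below sep] /subsetP sKJ /set0Pn[k0 k0K].
have [Z0 Z0s k0Z0] := below k0 (sKJ _ k0K).
have P_Z0 : (Z0 \in X :: s) && ~~ (K \subset Z0).
  by rewrite Z0s; apply: contra k0Z0 => /subsetP; apply.
(* Among chain members not containing [K], one of largest cardinality contains all the others. *)
have [Y /andP[Ys nKY] max_Y] :=
  @arg_maxnP _ Z0 (fun Z => (Z \in X :: s) && ~~ (K \subset Z)) (fun Z => #|Z|) P_Z0.
have sub_Y Z : Z \in X :: s -> ~~ (K \subset Z) -> Z \subset Y.
  move=> Zs nKZ; have := dchain_comparable chain_s => /andP[_ /forall_inP].
  move/(_ Z); rewrite inE => /(_ Zs)/forall_inP/(_ Y); rewrite inE => /(_ Ys).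
  case/orP=> // sYZ; have := max_Y Z; rewrite Zs nKZ => /(_ isT) leZY.
  by have /eqP-> : Y == Z by rewrite eqEcard sYZ.
have /subsetPn[k kK kY] := nKY.
(* A member splitting [u] from [k] does not contain [K], hence lies in [Y]; if [Y] missed both, so
   would that member. *)
have K_Y u : u \in K -> u != k -> u \in Y.
  move=> uK neq_uk; apply: contraT => uY.
  have [Z Zs neqZ] := sep u k (sKJ _ uK) (sKJ _ kK) neq_uk.
  have nKZ : ~~ (K \subset Z).
    by apply: contra neqZ => /subsetP sKZ; rewrite !sKZ.
  have /subsetP sZY := sub_Y Z Zs nKZ.
  by rewrite (contraNF (sZY u) uY) (contraNF (sZY k) kY) in neqZ.
have /imsetP[W _ defY] : Y \in Fl e by case/andP: chain_s => /allP/(_ _ Ys).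
have [w wW ewk] : exists2 w, w \in W & ~~ e w k.
  apply/exists_inP; rewrite -negb_forall_in; apply: contra kY => /forall_inP.
  by rewrite defY => stW; apply/StP.
(* Elements of [K] other than [k] lie in [Y = St e W], so they are adjacent to [w] and give zeros in
   row [w]. *)
exists w; rewrite -(cards1 k); congr #|pred_of_set _|; apply/setP=> u; rewrite !inE.
have [->|neq_uk] := eqVneq u k; first by rewrite kK.
apply/negP=> /andP[uK /negP]; apply.
by have := K_Y u uK neq_uk; rewrite defY => /StP; apply.
Qed.

End Flats.

Theorem theorem3p1 (V : finType) (e : rel V)
    (e_sym : symmetric e) (e_irr : irreflexive e) (J : {set V}) :
  [<-> independent J (fun j i => SB_of_bool (compl_adj e i j));
       has_witness (compl_adj e) J;
       height (fun X Y : {set V} => X \proper Y) (S_hat e J) = #|J|;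
       exists (X : {set V}) (s : seq {set V}),
         dchain (Fl e) X s /\ is_transv (differences X s) J;
       exists (X : {set V}) (s : seq {set V}),
         max_dchain (Fl e) X s /\ is_partial_transv (differences X s) J].
Proof.
tfae.
- by move=> /independentP single; apply/has_witnessP/triangular_exists.
- exact: height_S_hat_witness.
- exact: transv_of_height.
- case=> X [s [chain_s tr]]; have /andP[_ path_s] := chain_s.
  have [X' [s' [max_s' sub_s]]] := max_dchain_extends chain_s.
  exists X', s'; split=> //; have [/andP[_ path_s'] _] := max_s'.
  (* Separation passes from the given chain to the maximal chain refining it. *)
  apply: separated_partial_transv path_s' _.
  by apply: separated_sub (transv_separated path_s tr).
case=> X [s [[chain_s _] [J' tr sJJ']]]; have /andP[_ path_s] := chain_s.
apply/independentP => K; apply: single_row_of_separated chain_s _.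
by apply: separated_sub (transv_separated path_s tr).
Qed.
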